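(* Let $(X,d)$ be a complete metric space with $|X|\geqslant 3$, let $k\in\mathbb{N}$ with $3\leqslant k\leqslant |X|$, and let $T\colon X\to X$ be a perimetric contraction on $k$-polygons in $X$. If $T$ has no periodic points of prime period $i$ for any $i\in\{2,3,\ldots,k-1\}$, then $T$ has a fixed point in $X$. Moreover, $T$ has at most $k-1$ fixed points.
   Context: $|X|$ denotes the cardinality of $X$ (possibly infinite). For points $x_1,\ldots,x_k$ of a metric space $(X,d)$, $k\geqslant 3$, put $P(x_1,x_2,\ldots,x_k)=d(x_1,x_2)+d(x_2,x_3)+\cdots+d(x_{k-1},x_k)+d(x_k,x_1)$. For $k\geqslant 3$ and $|X|\geqslant k$, a map $T\colon X\to X$ is a perimetric contraction on $k$-polygons in $X$ if there exists $\lambda\in[0,1)$ such that $P(Tx_1,\ldots,Tx_k)\leqslant\lambda P(x_1,\ldots,x_k)$ for all $k$ pairwise distinct points $x_1,\ldots,x_k\in X$. A point $x\in X$ is a periodic point of period $p$ if $T^p x=x$; its prime period is the least positive integer $p$ with $T^p x=x$. *)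

(* Defs.v *)
From HB Require Import structures.
From mathcomp Require Import all_boot all_order all_algebra.
From mathcomp Require Import all_classical all_reals all_analysis.

Set Implicit Arguments.
Unset Strict Implicit.
Unset Printing Implicit Defensive.

Import Order.TTheory GRing.Theory Num.Theory.

Local Open Scope classical_set_scope.
Local Open Scope ring_scope.

(* [Complete] in MathComp-Analysis also carries a distinguished point; this only
   excludes the empty space. *)
#[short(type="completeMetricType")]
HB.structure Definition CompleteMetric (R : numDomainType) :=
  {T of Complete T & Metric R T}.

(* [ordS] is the cyclic successor on 'I_k, so the last summand is
   d(x_k, x_1). *)
Definition perimeter (R : realType) (X : metricType R) (k : nat)
    (x : 'I_k -> X) : R :=
  \sum_(i < k) mdist (x i) (x (ordS i)).

Definition perimetric_contraction (R : realType) (X : metricType R) (k : nat)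
    (T : X -> X) : Prop :=
  exists2 lambda : R, 0 <= lambda < 1 &
    forall x : 'I_k -> X, injective x ->
      perimeter (fun i => T (x i)) <= lambda * perimeter x.

Definition is_period (X : Type) (T : X -> X) (x : X) (p : nat) : Prop :=
  (0 < p)%N /\ iter p T x = x.

Definition is_prime_period (X : Type) (T : X -> X) (x : X) (p : nat) : Prop :=
  is_period T x p /\ forall q : nat, is_period T x q -> (p <= q)%N.

(* Main.v *)
(* Along the orbit of a point, absence of periods below k makes any k
   consecutive points pairwise distinct, so the perimeters of these windows
   decay geometrically: the orbit is Cauchy and, the perimeters being positive
   and strictly decreasing, injective. Its limit z is therefore eventually
   distinct from the orbit points, and contracting the polygons with vertices
   z, x_n, ..., x_{n+k-2} shows that x_{n+1} also tends to T z. *)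
Require Import Defs.
From mathcomp Require Import all_boot all_order all_algebra.
From mathcomp Require Import all_classical all_reals all_analysis.
From mathcomp Require Import lra zify.

Set Implicit Arguments.
Unset Strict Implicit.
Unset Printing Implicit Defensive.

Import Order.TTheory GRing.Theory Num.Theory.
Import numFieldNormedType.Exports.

Local Open Scope classical_set_scope.
Local Open Scope ring_scope.

(** Serves to extract [k] distinct fixed points when the bound [k - 1] fails. A finite [A] reduces
    to arithmetic on its cardinal; an infinite one contains a copy of the naturals. *)
Lemma card_leNI T (A : set T) (k : nat) :
  (0 < k)%N -> ~ (A #<= `I_(k - 1))%card -> (`I_k #<= A)%card.
Proof.
move=> k0 nA; have [[n An]|/infiniteP] := pselect (finite_set A); last first.
  by apply: card_le_trans; apply: subset_card_le.
rewrite (card_le_eqr An) card_le_II; rewrite (card_le_eql An) card_le_II in nA.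
lia.
Qed.

Section Perimeter.
Context (R : realType) (X : metricType R) (k : nat).
Implicit Types x : 'I_k -> X.

Lemma perimeter_ge_edge x i : mdist (x i) (x (ordS i)) <= perimeter x.
Proof.
rewrite /perimeter (bigD1 i)//= lerDl.
by apply: sumr_ge0 => j _; exact: mdist_ge0.
Qed.

Lemma perimeter_gt0 x : (1 < k)%N -> injective x -> 0 < perimeter x.
Proof.
move=> k1 xI; have k0 : (0 < k)%N by lia.
apply: lt_le_trans (perimeter_ge_edge x (Ordinal k0)).
by rewrite mdist_gt0; apply/eqP => /xI/(congr1 val)/=; rewrite modn_small.
Qed.

Lemma perimeter_le_ball x (z : X) (e : R) :
  (forall i, mdist z (x i) <= e) -> perimeter x <= (e + e) *+ k.
Proof.
move=> xe; rewrite -[k in _ *+ k]card_ord -sumr_const; apply: ler_sum => i _.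
apply: (le_trans (metric_triangle _ z _)).
by rewrite lerD// metric_sym.
Qed.

End Perimeter.

(** Any [k] distinct fixed points would form a polygon that [T] leaves unchanged, so its positive
    perimeter would be at most [l < 1] times itself. *)
Lemma fixed_points_card_le (R : realType) (X : completeMetricType R) (k : nat)
    (T : X -> X) :
  (1 < k)%N -> perimetric_contraction k T ->
  ([set x : X | T x = x] #<= `I_(k - 1))%card.
Proof.
move=> k1 [l /andP[l0 l1] Tl]; apply: contrapT => nle.
have /pcard_leP[f] := card_leNI (ltnW k1) nle.
pose x (i : 'I_k) : X := f i.
have fixx i : T (x i) = x i by exact: (@funS _ _ _ _ f (val i) (ltn_ord i)).
have xI : injective x.
  by move=> i j /(@inj _ _ _ f _ _ (mem_set (ltn_ord i)) (mem_set (ltn_ord j)))/val_inj.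
have := Tl x xI; have := perimeter_gt0 k1 xI.
have -> : perimeter (fun i => T (x i)) = perimeter x.
  by apply: eq_bigr => i _; rewrite !fixx.
nra.
Qed.

Lemma cauchy_geometric_dist (R : realType) (X : metricType R) (u : nat -> X)
    (c l : R) :
  0 <= l < 1 -> (forall n, mdist (u n) (u n.+1) <= c * l ^+ n) ->
  cauchy (u @ \oo).
Proof.
(* [C * l ^+ n] is the sum of the geometric tail starting at [c * l ^+ n]. *)
move=> /andP[l0 l1] ul; pose C := c / (1 - l).
have CE : c = C * (1 - l) by rewrite /C divfK//; lra.
(* Keeping the remaining tail on the left lets the induction close without partial sums. *)
have dist_tail n m : mdist (u n) (u (n + m)%N) + C * l ^+ (n + m) <= C * l ^+ n.
  elim: m => [|m IH]; first by rewrite addn0 mdistxx add0r.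
  have := metric_triangle (u n) (u (n + m)%N) (u (n + m.+1)%N).
  have := ul (n + m)%N; rewrite addnS exprS CE; nra.
have C0 : 0 <= C.
  rewrite /C divr_ge0//; last lra.
  by have := ul 0%N; rewrite expr0 mulr1; apply: le_trans; exact: mdist_ge0.
have Cl0 : (fun n => C * l ^+ n) @ \oo --> (0 : R).
  by apply: cvg_geometric; rewrite ger0_norm.
apply: cauchy_exP => e e0.
have [N _ /(_ N (leqnn N))/= CN] : \forall n \near \oo, C * l ^+ n < e.
  by move/cvgr_lt : Cl0; apply.
exists (u N); exists N => // n /= Nn; rewrite ballEmdist/=.
have := dist_tail N (n - N)%N; rewrite subnKC//.
have : 0 <= C * l ^+ n by rewrite mulr_ge0// exprn_ge0.
lra.
Qed.

Section PrimePeriod.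
Context (X : Type) (T : X -> X).

Lemma is_prime_period_le x p :
  is_period T x p -> exists2 q, is_prime_period T x q & (q <= p)%N.
Proof.
move=> Tp; have ex : exists n, `[< is_period T x n >] by exists p; apply/asboolP.
have [q /asboolP Tq qmin] := ex_minnP ex.
by exists q; [split=> // r Tr|]; apply: qmin; apply/asboolP.
Qed.

(** A period below [k] bounds the least period of the point, which is then either 1, giving a fixed
    point, or in the excluded range. *)
Lemma short_period_free (k : nat) :
  (forall i, (2 <= i <= k - 1)%N -> ~ exists x, is_prime_period T x i) ->
  (forall x, T x <> x) ->
  forall x p, (0 < p < k)%N -> iter p T x <> x.
Proof.
move=> noper nofix x p /andP[p0 pk] Tp.
have [q [[q0 Tq] qmin] qp] := is_prime_period_le (conj p0 Tp).
case: q => [|[|q]] // in q0 Tq qmin qp *; first exact: nofix Tq.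
apply: (noper q.+2); first lia.
by exists x.
Qed.

End PrimePeriod.

Section Orbit.
Context (R : realType) (X : metricType R) (k : nat) (T : X -> X) (l : R).
Hypotheses (k1 : (1 < k)%N) (l01 : 0 <= l < 1).
Hypothesis Tl : forall x : 'I_k -> X, injective x ->
  perimeter (fun i => T (x i)) <= l * perimeter x.
Hypothesis Tfree : forall x p, (0 < p < k)%N -> iter p T x <> x.
Variable x0 : X.

Let u n := iter n T x0.
Let window n (i : 'I_k) := u (n + i).

Let uD n m : iter m T (u n) = u (n + m).
Proof. by rewrite /u addnC iterD. Qed.

(** A repetition at places [i < j] would give [u (n + i)] the period [j - i], which is below [k]. *)
Lemma orbit_window_inj n : injective (window n).
Proof.
suff window_neq (i j : 'I_k) : (i < j)%N -> window n i <> window n j.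
  move=> i j ij; apply/val_inj.
  by case: (ltngtP i j) => // /window_neq; case; rewrite ij.
move=> ij; rewrite /window => uij.
apply: (@Tfree (u (n + i)) (j - i)%N).
  by rewrite subn_gt0 ij (leq_ltn_trans (leq_subr _ _)).
by rewrite uD -addnA subnKC// ltnW.
Qed.

Let P n := perimeter (window n).

Let P_gt0 n : 0 < P n.
Proof. exact/perimeter_gt0/orbit_window_inj. Qed.

Let PS n : P n.+1 <= l * P n.
Proof. exact/Tl/orbit_window_inj. Qed.

Let P_le n : P n <= P 0 * l ^+ n.
Proof.
elim: n => [|n IH]; first by rewrite expr0 mulr1.
apply: (le_trans (PS n)); rewrite exprS mulrCA ler_wpM2l//.
by case/andP: l01.
Qed.

Lemma orbit_inj : injective (fun n => iter n T x0).
Proof.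
have Pdecr m n : (m < n)%N -> P n < P m.
  elim: n => // n IH; rewrite ltnS leq_eqVlt => mn.
  apply: (@lt_le_trans _ _ (P n)).
    by have := PS n; have := P_gt0 n; case/andP: l01; nra.
  by case/predU1P: mn => [->//|/IH/ltW].
(* Equal orbit points have equal iterates, hence start identical windows. *)
have Peq m n : u m = u n -> P m = P n.
  by move=> mn; apply: eq_bigr => i _; rewrite /window -!uD mn.
move=> m n /Peq mn; case: (ltngtP m n) => // /Pdecr; rewrite mn ltxx//.
Qed.

Lemma orbit_cauchy : cauchy ((fun n => iter n T x0) @ \oo).
Proof.
apply: (cauchy_geometric_dist (c := P 0) l01) => n.
have k0 : (0 < k)%N by lia.
apply: le_trans (P_le n); have := perimeter_ge_edge (window n) (Ordinal k0).
by rewrite /window/= addn0 modn_small// addn1.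
Qed.

Lemma orbit_limit_fixed z : ((fun n => iter n T x0) @ \oo --> z) -> T z = z.
Proof.
move=> uz; apply: mdist_positivity; apply/eqP; rewrite eq_le mdist_ge0 andbT.
apply/ler_addgt0Pl => e e0; rewrite addr0.
(* Chosen so that [d + (d + d) *+ k = e]: one [d] for the distance from [z] to [u n.+1], and [d + d]
   for each of the [k] edges of the polygon [y]. *)
pose d := e / (1 + 2 *+ k).
have den : 0 < 1 + 2 *+ k :> R by rewrite ltr_wpDr// mulrn_wge0.
have d0 : 0 < d by rewrite divr_gt0.
have [N _ uN] : \forall n \near \oo, mdist z (u n) < d.
  by move/metricType_numDomainType.cvgrPdist_lt : uz; apply.
(* By injectivity the orbit meets [z] at most once. *)
have [M uM] : exists M, forall n, (M <= n)%N -> u n <> z.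
  have [[m um]|nm] := pselect (exists m, u m = z).
    by exists m.+1 => n mn; rewrite -um => /orbit_inj nm; rewrite nm ltnn in mn.
  by exists 0%N => n _ un; apply: nm; exists n.
pose n := maxn N M.
pose y (i : 'I_k) := if val i is j.+1 then u (n + j) else z.
have y_inj : injective y.
  have uMn j : u (n + j) <> z by apply: uM; rewrite /n; lia.
  move=> [[|i] ik] [[|j] jk]; rewrite /y/= => yij; apply/val_inj => //=.
  - by case: (uMn j).
  - by case: (uMn i).
  - by move/orbit_inj: yij; lia.
have y_near i : mdist z (y i) <= d.
  rewrite /y; case: (val i) => [|j]; first by rewrite mdistxx ltW.
  by apply/ltW/uN => /=; rewrite /n; lia.
have k0 : (0 < k)%N by lia.
have := perimeter_ge_edge (fun i => T (y i)) (Ordinal k0).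
(* Edge 0 of the image polygon joins [T z] to [T (u n)], which is [u n.+1]. *)
rewrite {2}/y/= modn_small// addn0 => Tzu.
have {}Tzu : mdist (T z) (u n.+1) <= (d + d) *+ k.
  apply: (le_trans Tzu); apply: (le_trans (Tl y_inj)).
  apply: le_trans (perimeter_le_ball y_near).
  case/andP: l01 => _ /ltW l1; rewrite ler_piMl//.
  exact/ltW/perimeter_gt0.
have uz1 : mdist z (u n.+1) < d by apply: uN => /=; rewrite /n; lia.
have -> : e = d + (d + d) *+ k.
  have -> : d + (d + d) *+ k = d * (1 + 2 *+ k).
    by rewrite mulrDr mulr1 mulrnAr mulr_natr mulr2n.
  by rewrite /d divfK// gt_eqF.
apply: (le_trans (metric_triangle _ (u n.+1) _)).
rewrite addrC lerD//.
by rewrite metric_sym ltW.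
Qed.

End Orbit.

Local Close Scope ring_scope.
Local Open Scope card_scope.

Theorem theorem2p10 (R : realType) (X : completeMetricType R)
    (hX3 : `I_3 #<= [set: X])
    (k : nat) (hk3 : (3 <= k)%N) (hkX : `I_k #<= [set: X])
    (T : X -> X) (hT : perimetric_contraction k T) :
  ((forall i : nat, (2 <= i <= k - 1)%N ->
      ~ exists x : X, is_prime_period T x i) ->
   exists x : X, T x = x) /\
  [set x : X | T x = x] #<= `I_(k - 1).
Proof.
have k1 : (1 < k)%N by lia.
split; last exact: fixed_points_card_le.
move=> noper; have [l l01 Tl] := hT.
(* Denying fixed points also excludes prime period 1, so no point has a period below [k]. *)
apply: contrapT => nofix.
have Tfree : forall x p, (0 < p < k)%N -> iter p T x <> x.
  by apply: short_period_free noper _ => x Tx; apply: nofix; exists x.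
(* The starting point is arbitrary; [point] is the distinguished element of [X]. *)
have /cauchy_cvgP/cvg_ex[z uz] := orbit_cauchy k1 l01 Tl Tfree point.
by apply: nofix; exists z; exact: (orbit_limit_fixed k1 l01 Tl Tfree uz).
Qed.
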